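(* Let $r\ge 2$, $d\ge 1$ be integers, $n=(r-1)(d+1)+1$, and let $A\subset\mathbb{R}^d$ be a set of $n$ points whose $dn$ coordinates are algebraically independent. Let $M\subset A$ with $|M|\le r-1$ and $\operatorname{conv} M\cap \operatorname{conv}(A\setminus M)=\emptyset$. Then there is a partition $\{A_1,\ldots,A_r\}$ of $A$ and a solution $(z,\alpha)$, $z\in\mathbb{R}^d$, $\alpha:A\to\mathbb{R}$, of the system \[ z=\sum_{x\in A_j}\alpha(x)\,x \quad\text{and}\quad 1=\sum_{x\in A_j}\alpha(x)\qquad\text{for all } j\in[r], \] such that $\alpha(x)<0$ if and only if $x\in M$.
   Context: $[r]=\{1,\ldots,r\}$; $\operatorname{conv}$ denotes convex hull, and $\operatorname{conv}\emptyset=\emptyset$. The condition on $M$ means that $M$ and $A\setminus M$ can be separated by a hyperplane. *)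

(* Defs.v *)
From HB Require Import structures.
From mathcomp Require Import all_boot all_order all_algebra.
Set Implicit Arguments. Unset Strict Implicit. Unset Printing Implicit Defensive.
Import Order.TTheory GRing.Theory Num.Theory.
Local Open Scope ring_scope.

(* A finite family x : I -> R of elements of a field of characteristic 0 is
   algebraically independent (over Q) iff the distinct monomials in the x i
   are linearly independent over Q, i.e. no nonzero polynomial with rational
   coefficients vanishes at x.  A polynomial is given by a finite list of
   pairwise distinct exponent vectors e : {ffun I -> nat} and rational
   coefficients c e. *)
Definition alg_indep (R : fieldType) (I : finType) (x : I -> R) : Prop :=
  forall (s : seq {ffun I -> nat}) (c : {ffun I -> nat} -> rat),
    uniq s ->
    \sum_(e <- s) ratr (c e) * \prod_(i : I) x i ^+ e i = 0 ->
    forall e, e \in s -> c e = 0.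

(* z lies in the convex hull of the points {a i | i \in S}
   (conv of the empty set is empty: the weights must sum to 1). *)
Definition in_conv (R : realFieldType) (n d : nat) (a : 'I_n -> 'rV[R]_d)
    (S : {set 'I_n}) (z : 'rV[R]_d) : Prop :=
  exists w : 'I_n -> R,
    [/\ forall i, 0 <= w i,
        forall i, i \notin S -> w i = 0,
        \sum_(i < n) w i = 1
      & z = \sum_(i < n) w i *: a i].

(* Main.v *)
Require Import Defs.
From HB Require Import structures.
From mathcomp Require Import all_boot all_order all_algebra.
From mathcomp Require Import mpoly ring lra zify.
Import Order.TTheory GRing.Theory Num.Theory.
Local Open Scope ring_scope.
Set Implicit Arguments. Unset Strict Implicit. Unset Printing Implicit Defensive.

(* Lift each point x to (x, 1) and change the sign of the lifts of the points
   of M.  Separation means that the signed lifts y(x) admit no nontrivial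
   nonnegative dependency.  The conic form of Tverberg's theorem, deduced from
   the colourful Caratheodory theorem by Sarkaria's tensor trick, splits them
   into r blocks having a common nonnegative combination w, and separation
   forces w <> 0.  One of the r blocks avoids the at most r - 1 points of M, so
   the last coordinate of w is positive and can be normalized to 1.  The
   coefficients do not vanish because, for algebraically independent
   coordinates, fewer than n points cannot have such a common point: this is
   the nonvanishing of a determinant, hence of a polynomial with rational
   coefficients, and it suffices to check it on one rational configuration. *)

(** * Linear dependencies and the dot product *)

Lemma row_dependency (K : fieldType) n m (A : 'M[K]_(n, m)) : ~~ row_free A ->
  exists c : 'I_n -> K, \sum_i c i *: row i A = 0 /\ exists i, c i != 0.
Proof.
rewrite -kermx_eq0 => /rowV0Pn[c /sub_kermxP cA c0].
exists (c 0); rewrite -mulmx_sum_row; split=> //.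
apply/existsP; rewrite -negb_forall; apply: contra c0 => /forallP c0.
by apply/eqP/rowP => i; rewrite mxE; apply/eqP.
Qed.

Section DotProduct.
Variables (R : realFieldType) (m : nat).
Implicit Types u v w : 'rV[R]_m.

Definition dot u v : R := \sum_k u 0 k * v 0 k.

Lemma dotC u v : dot u v = dot v u.
Proof. by apply: eq_bigr => k _; rewrite mulrC. Qed.

Lemma dotDl u v w : dot (u + v) w = dot u w + dot v w.
Proof. by rewrite -big_split; apply: eq_bigr => k _; rewrite mxE mulrDl. Qed.

Lemma dotZl a u w : dot (a *: u) w = a * dot u w.
Proof. by rewrite /dot mulr_sumr; apply: eq_bigr => k _; rewrite mxE mulrA. Qed.

Lemma dotBl u v w : dot (u - v) w = dot u w - dot v w.
Proof. by rewrite -scaleN1r dotDl dotZl mulN1r. Qed.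

Lemma dot_suml (I : finType) (c : I -> R) (u : I -> 'rV[R]_m) w :
  dot (\sum_i c i *: u i) w = \sum_i c i * dot (u i) w.
Proof.
rewrite /dot; under [RHS]eq_bigr do rewrite mulr_sumr.
rewrite exchange_big; apply: eq_bigr => k _.
by rewrite summxE mulr_suml; apply: eq_bigr => i _; rewrite mxE mulrA.
Qed.

Lemma dot_ge0 u : 0 <= dot u u.
Proof. by apply: sumr_ge0 => k _; rewrite -expr2 sqr_ge0. Qed.

Lemma dot_sqrD a u v : dot (u + a *: v) (u + a *: v) =
  dot u u + 2 * a * dot u v + a ^+ 2 * dot v v.
Proof. by rewrite dotDl dotZl !(dotC _ (u + _)) !dotDl !dotZl (dotC v u); ring. Qed.

Lemma dot_pythagoras a u v : dot u v = 0 ->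
  dot (u + a *: v) (u + a *: v) = dot u u + a ^+ 2 * dot v v.
Proof. by move=> uv0; rewrite dot_sqrD uv0 mulr0 addr0. Qed.

Lemma dot_eq0 u : (dot u u == 0) = (u == 0).
Proof.
apply/eqP/eqP => [/psumr_eq0P H|->]; last first.
  by apply: big1 => k _; rewrite mxE mul0r.
apply/rowP => k; rewrite mxE; apply/eqP; rewrite -sqrf_eq0 expr2.
by rewrite H // => j _; rewrite -expr2 sqr_ge0.
Qed.

Lemma mulmx_trE p q (A : 'M[R]_(p, m)) (B : 'M[R]_(q, m)) i j :
  (A *m B^T) i j = dot (row i A) (row j B).
Proof. by rewrite mxE; apply: eq_bigr => k _; rewrite !mxE. Qed.

End DotProduct.

(** * Orthogonal projection and descent on conic combinations *)

Section ConicCombinations.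
Variables (R : realFieldType) (m : nat).

(** A row [k] killed by [A *m A^T] makes [k *m A] of squared norm 0, so both matrices have the same
    rank. This makes the normal equations of least squares solvable. *)
Lemma gram_eqmx p (A : 'M[R]_(p, m)) : (A^T <= A *m A^T)%MS.
Proof.
have sAA : (A *m A^T <= A^T)%MS := submxMl _ _.
rewrite -(geq_leqif (mxrank_leqif_sup sAA)) mxrank_tr.
have: (kermx (A *m A^T) <= kermx A)%MS.
  apply/sub_kermxP/eqP; set K := kermx _.
  have K0 : K *m A *m (K *m A)^T = 0.
    by rewrite trmx_mul mulmxA -(mulmxA K) mulmx_ker mul0mx.
  apply/eqP/row_matrixP => i; rewrite row0; apply/eqP.
  by rewrite -dot_eq0 -mulmx_trE K0 mxE.
move=> /mxrankS; rewrite !mxrank_ker.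
have := rank_leq_row (A *m A^T); have := rank_leq_row A; lia.
Qed.

Lemma orthogonal_projection (I : finType) (u : I -> 'rV[R]_m) (S : {set I})
    (b : 'rV[R]_m) :
  exists c : I -> R, (forall i, i \notin S -> c i = 0) /\
    forall i, i \in S -> dot (b - \sum_i c i *: u i) (u i) = 0.
Proof.
(* Zero rows stand for the indices outside [S], so that all of [I] indexes the rows. *)
pose A := \matrix_(k < #|I|)
  (if enum_val k \in S then u (enum_val k) else 0 : 'rV[R]_m).
have /submxP[x xP] : (b *m A^T <= A *m A^T)%MS.
  exact: submx_trans (submxMl _ _) (gram_eqmx _).
pose c i := if i \in S then x 0 (enum_rank i) else 0.
have Ec : x *m A = \sum_i c i *: u i.
  rewrite mulmx_sum_row (reindex enum_rank) /=; last first.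
    by apply: onW_bij; apply: enum_rank_bij.
  apply: eq_bigr => i _; rewrite rowK enum_rankK /c.
  by case: ifP => _; rewrite ?scaler0 ?scale0r.
exists c; split => [i /negbTE iS|i iS]; first by rewrite /c iS.
have : (b - x *m A) *m A^T = 0 by rewrite mulmxBl -mulmxA xP subrr.
by move/rowP/(_ (enum_rank i)); rewrite mulmx_trE row_id rowK enum_rankK iS -Ec mxE.
Qed.

(** Ratio test: [t] is the last time at which the ray from [g] in direction [c] is still in the
    nonnegative orthant. *)
Lemma boundary_point (I : finType) (g c : I -> R) :
    (forall i, 0 <= g i) -> (exists i, c i < 0) ->
  exists t i0, [/\ 0 <= t, c i0 < 0, g i0 + t * c i0 = 0
    & forall i, 0 <= g i + t * c i].
Proof.
move=> g0 [i1 ci1].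
case: (@arg_minP _ _ _ i1 (fun i => c i < 0) (fun i => g i / - c i) ci1).
move=> i0 ci0 min0; exists (g i0 / - c i0), i0.
have t0 : 0 <= g i0 / - c i0 by rewrite divr_ge0 // oppr_ge0 ltW.
have ci0' : c i0 != 0 by rewrite lt_eqF.
split=> // [|i]; first by field.
case: (ltP (c i) 0) => [ci|ci]; last exact: addr_ge0 (g0 i) (mulr_ge0 t0 ci).
by have := min0 i ci; rewrite ler_pdivlMr ?oppr_gt0 // mulrN; lra.
Qed.


Definition residual (I : finType) (u : I -> 'rV[R]_m) (b : 'rV[R]_m)
    (g : I -> R) :=
  b - \sum_i g i *: u i.

Lemma residualD (I : finType) (u : I -> 'rV[R]_m) (b : 'rV[R]_m) (g c : I -> R) t :
  residual u b (fun i => g i + t * c i) =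
    residual u b g - t *: \sum_i c i *: u i.
Proof.
rewrite /residual -addrA -opprD scaler_sumr -big_split /=; congr (_ - _).
by apply: eq_bigr => i _; rewrite scalerDl scalerA.
Qed.

Lemma dot_sum0 (I : finType) (u : I -> 'rV[R]_m) (c : I -> R) (v : 'rV[R]_m) :
    (forall i, c i != 0 -> dot v (u i) = 0) ->
  dot v (\sum_i c i *: u i) = 0.
Proof.
move=> v0; rewrite dotC dot_suml big1 // => i _.
by case: (eqVneq (c i) 0) => [->|/v0]; rewrite ?mul0r // dotC => ->; rewrite mulr0.
Qed.

(** Project [b] onto the span of the vectors in use. If the coefficients [c] of the projection are
    nonnegative, take them; otherwise go from [g] towards [c] until a coefficient vanishes, which
    does not lengthen the residual, and recurse on the smaller support. *)
Lemma conic_descent (I : finType) (u : I -> 'rV[R]_m) (b : 'rV[R]_m) (g : I -> R) :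
    (forall i, 0 <= g i) ->
  exists g' : I -> R, [/\ forall i, 0 <= g' i,
    dot (residual u b g') (residual u b g') <= dot (residual u b g) (residual u b g)
  & forall i, g' i != 0 -> dot (residual u b g') (u i) = 0].
Proof.
have [k] := ubnP #|[set i | g i != 0]|; elim: k g => // k IH g ltk g0.
have [c [cS cdot]] := orthogonal_projection u [set i | g i != 0] b.
have {}cS i : g i = 0 -> c i = 0 by move=> gi; rewrite cS // inE gi eqxx.
have {}cdot i : g i != 0 -> dot (residual u b c) (u i) = 0.
  by move=> gi; apply: cdot; rewrite inE.
pose e : 'rV[R]_m := \sum_i (c i - g i) *: u i.
have re t : residual u b (fun i => g i + t * (c i - g i)) =
    residual u b c + (1 - t) *: e.
  rewrite residualD -/e scalerBl scale1r addrA; congr (_ + _).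
  rewrite /residual -addrA; congr (_ + _); rewrite /e.
  under [X in _ = _ + X]eq_bigr do rewrite scalerBl.
  by rewrite sumrB addKr.
have ce0 : dot (residual u b c) e = 0.
  apply: dot_sum0 => // i; apply: contraNeq => /eqP cdi.
  case: (eqVneq (g i) 0) cdi => [gi|/cdot //].
  by rewrite cS // gi subrr.
have rg : residual u b g = residual u b c + (1 - 0) *: e.
  by rewrite -re; congr (_ - _); apply: eq_bigr => i _; rewrite mul0r addr0.
case: (boolP [forall i, 0 <= c i]) => [/forallP c0|]; last first.
  rewrite negb_forall => /existsP[i1]; rewrite -ltNge => ci1.
  have [|t [i0 [t0 ci0 gi0 gt]]] := @boundary_point I g (fun i => c i - g i) g0.
    by exists i1; rewrite subr_lt0 (lt_le_trans ci1).
  have gi0' : g i0 != 0 by apply: contraTneq ci0 => gi; rewrite cS // gi subrr ltxx.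
  (* Beyond [t = 1] the coefficient at [i1] would be negative, as [c i1 < 0]. *)
  have t1 : t <= 1.
    have := gt i1; have := g0 i1; nra.
  have [|g' [g'0 le_g' g'dot]] := IH (fun i => g i + t * (c i - g i)) _ gt.
    rewrite -ltnS; apply: leq_ltn_trans ltk; apply: proper_card; apply/properP; split.
      apply/subsetP => i; rewrite !inE; apply: contraNneq => gi.
      by rewrite cS // gi subrr mulr0 addr0.
    by exists i0; rewrite !inE ?gi0 ?eqxx.
  exists g'; split=> //; apply: le_trans le_g' _.
  rewrite re rg !dot_pythagoras // lerD2l ler_wpM2r ?dot_ge0 //.
  nra.
exists c; split => // [|i ci]; last first.
  by apply: cdot; apply: contra_neq ci => /cS.
by rewrite rg dot_pythagoras // lerDl mulr_ge0 ?dot_ge0 ?sqr_ge0.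
Qed.

(** The vectors lie in the hyperplane orthogonal to [v], of dimension [m - 1 < n]. *)
Lemma exists_dependency n (u : 'I_n -> 'rV[R]_m) (v : 'rV[R]_m) :
    (m <= n)%N -> v != 0 -> (forall i, dot v (u i) = 0) ->
  exists c : 'I_n -> R, \sum_i c i *: u i = 0 /\ exists i, c i < 0.
Proof.
move=> lemn v0 uv0; pose A := \matrix_i u i.
have Av : A *m v^T = 0.
  by apply/matrixP => i j; rewrite mulmx_trE rowK row_id mxE dotC.
have [|c [c0 [i ci]]] := @row_dependency _ _ _ A.
  apply: contra v0 => /eqP rkA; have fullA : row_full A.
    by rewrite /row_full eqn_leq rank_leq_col rkA.
  have /row_fullP[B BA] := fullA.
  by rewrite -[v]trmxK -[v^T]mul1mx -BA -mulmxA Av mulmx0 trmx0.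
have sum0 : \sum_i c i *: u i = 0.
  by rewrite -[RHS]c0; apply: eq_bigr => k _; rewrite rowK.
case: (ltP (c i) 0) => [lt0|ge0]; first by exists c; split=> //; exists i.
exists (fun i => - c i); split; last first.
  by exists i; rewrite oppr_lt0 lt_neqAle eq_sym ci.
by under eq_bigr do rewrite scaleNr; rewrite sumrN sum0 oppr0.
Qed.

(** Both are residuals of the projection onto the span of the same vectors: their difference lies in
    that span and is orthogonal to it. *)
Lemma residual_unique (I : finType) (u : I -> 'rV[R]_m) (b : 'rV[R]_m) (g h : I -> R) :
    (forall i, (g i == 0) = (h i == 0)) ->
    (forall i, g i != 0 -> dot (residual u b g) (u i) = 0) ->
    (forall i, h i != 0 -> dot (residual u b h) (u i) = 0) ->
  residual u b g = residual u b h.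
Proof.
move=> gh g0 h0; apply/eqP; rewrite -subr_eq0 -dot_eq0.
have Er : residual u b g - residual u b h = \sum_i (h i - g i) *: u i.
  rewrite /residual opprB addrC addrA subrK.
  by under [RHS]eq_bigr do rewrite scalerBl; rewrite sumrB.
rewrite [X in dot _ X]Er dot_sum0 // => i hgi.
have gi : g i != 0.
  apply: contraNneq hgi => gi; have /eqP-> : h i == 0 by rewrite -gh gi.
  by rewrite gi subrr.
by rewrite dotBl g0 ?h0 ?subrr -?gh.
Qed.

(** * The colourful Caratheodory theorem for cones *)

Section Colorful.
Variables (n : nat) (J : finType) (u : 'I_n -> J -> 'rV[R]_m) (b : 'rV[R]_m).
Variable lam : 'I_n -> J -> R.
Hypothesis lemn : (m <= n)%N.
Hypothesis lam_ge0 : forall i j, 0 <= lam i j.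
Hypothesis lamE : forall i, \sum_j lam i j *: u i j = b.

Let res (f : {ffun 'I_n -> J}) (g : 'I_n -> R) :=
  residual (fun i => u i (f i)) b g.

Definition stationary f g :=
  (forall i, 0 <= g i) /\ forall i, g i != 0 -> dot (res f g) (u i (f i)) = 0.

(** Bárány's exchange: free a slot [i0] without changing the residual [r], then fill it with a
    vector of the same colour on the positive side of [r], which exists because [dot r b > 0]. *)
Lemma stationary_improve f g : stationary f g -> res f g != 0 ->
  exists f' g', stationary f' g' /\
    dot (res f' g') (res f' g') < dot (res f g) (res f g).
Proof.
move=> [g0 gdot] r0; set r := res f g in gdot r0 *.
have [g1 [i0 [g1_ge0 g1i0 rg1]]] : exists g1 i0,
    [/\ forall i, 0 <= g1 i, g1 i0 = 0 & res f g1 = r].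
  case: (boolP [exists i, g i == 0]) => [/existsP[i0 /eqP gi0]|].
    by exists g, i0.
  rewrite negb_exists => /forallP gn0.
  (* All vectors are in use, hence orthogonal to [r]; moving along a dependency frees a slot. *)
  have [c [c0 cneg]] := exists_dependency lemn r0 (fun i => gdot i (gn0 i)).
  have [t [i0 [_ _ gi0 gt]]] := boundary_point g0 cneg.
  exists (fun i => g i + t * c i), i0; split=> //.
  by rewrite /res residualD c0 scaler0 subr0.
have rb : 0 < dot r b.
  have -> : b = r + \sum_i g i *: u i (f i) by rewrite subrK.
  rewrite dotC dotDl (dotC _ r) dot_sum0 // addr0.
  by rewrite lt_neqAle dot_ge0 eq_sym dot_eq0 r0.
have [j rj] : exists j, 0 < dot r (u i0 j).
  apply/existsP; apply: contraTT rb; rewrite negb_exists -leNgt => /forallP rle.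
  rewrite -(lamE i0) dotC dot_suml; apply: sumr_le0 => j _.
  by apply: mulr_ge0_le0 => //; rewrite dotC leNgt.
have uj : 0 < dot (u i0 j) (u i0 j).
  rewrite lt_neqAle dot_ge0 eq_sym dot_eq0 andbT; apply: contraTneq rj => ->.
  by rewrite dotC -(scale0r 0) dotZl mul0r ltxx.
(* This [s] minimizes the norm of [r - s *: u i0 j]. *)
pose s := dot r (u i0 j) / dot (u i0 j) (u i0 j).
pose f' : {ffun 'I_n -> J} := [ffun i => if i == i0 then j else f i].
pose g2 i := if i == i0 then s else g1 i.
have g2_ge0 i : 0 <= g2 i.
  by rewrite /g2; case: eqP => // _; rewrite divr_ge0 ?dot_ge0 // ltW.
have rg2 : res f' g2 = r - s *: u i0 j.
  rewrite -rg1 /res /residual -addrA -opprD; congr (_ - _).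
  rewrite (bigD1 i0) // [X in _ = X + _](bigD1 i0) //= /g2 ffunE eqxx g1i0.
  rewrite scale0r add0r addrC; congr (_ + _).
  by apply: eq_bigr => i /negbTE ii0; rewrite ffunE ii0.
have [g' [g'0 leg' g'dot]] := conic_descent (fun i => u i (f' i)) b g2_ge0.
exists f', g'; split=> //; apply: le_lt_trans leg' _.
rewrite -/(res f' g2) rg2 -scaleNr dot_sqrD sqrrN expr2 -[s * s * _]mulrA.
have -> : s * dot (u i0 j) (u i0 j) = dot r (u i0 j).
  by rewrite divfK // gt_eqF.
have sr : 0 < s * dot r (u i0 j) by rewrite mulr_gt0 ?divr_gt0.
by lra.
Qed.

Let code (f : {ffun 'I_n -> J}) (g : 'I_n -> R) := (f, [set i | g i != 0]).

(* A stationary residual is determined by the choice f and the support of g,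
   so there are finitely many of them and the strict descent terminates; this
   replaces the compactness argument, unavailable over an ordered field. *)
Theorem colorful_cone (j0 : J) : exists (f : 'I_n -> J) (g : 'I_n -> R),
  (forall i, 0 <= g i) /\ \sum_i g i *: u i (f i) = b.
Proof.
(* [Z] holds codes already passed: stationary pairs with a code in [Z] have strictly longer
   residuals, so each improvement brings a new code. *)
have descent (Z : {set {ffun 'I_n -> J} * {set 'I_n}}) f g : stationary f g ->
    (forall f1 g1, stationary f1 g1 -> code f1 g1 \in Z ->
      dot (res f g) (res f g) < dot (res f1 g1) (res f1 g1)) ->
    exists f' g', stationary f' g' /\ res f' g' = 0.
  have [k] := ubnP #|~: Z|; elim: k Z f g => // k IH Z f g ltk sfg ltZ.
  case: (eqVneq (res f g) 0) => [r0|r0]; first by exists f, g.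
  have [f' [g' [sfg' lt']]] := stationary_improve sfg r0.
  apply: (IH (code f g |: Z)) sfg' _.
    rewrite -ltnS; apply: leq_ltn_trans ltk; apply: proper_card.
    apply/properP; split; first by rewrite setCS subsetUr.
    exists (code f g); last by rewrite !inE eqxx.
    by rewrite inE; apply/negP => /(ltZ _ _ sfg); rewrite ltxx.
  move=> f1 g1 sfg1 /setU1P[[ef /setP eg]|/(ltZ _ _ sfg1)]; last exact: lt_trans.
  rewrite ef in sfg1 *; suff -> : res f g1 = res f g by [].
  apply: residual_unique sfg1.2 sfg.2 => i.
  by have := eg i; rewrite !inE => /negb_inj.
have [|g [g0 _ gdot]] := conic_descent (fun i => u i j0) b (g := fun=> 0) => //.
have [||f' [g' [[g'0 _] r0]]] := descent set0 [ffun=> j0] g.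
- split=> // i /gdot; rewrite ffunE => <-; congr (dot (b - _) _).
  by apply: eq_bigr => k _; rewrite ffunE.
- by move=> f1 g1 _; rewrite inE.
by exists f', g'; split=> //; apply/eqP; rewrite eq_sym -subr_eq0; apply/eqP.
Qed.

End Colorful.

End ConicCombinations.

(** * Sarkaria's tensor trick and the conic Tverberg theorem *)

Section Tverberg.
Variable R : realFieldType.

(* The r vectors in dimension r - 1 whose only linear dependency, up to
   scaling, is that their sum vanishes (Sarkaria's trick). *)
Definition sarkaria_vector r (j : 'I_r.+1) : 'rV[R]_r :=
  \row_k ((j == lift ord_max k)%:R - (j == ord_max)%:R).

Lemma sum_sarkaria_vector r : \sum_j sarkaria_vector (r := r) j = 0.
Proof.
have sum1 j0 : \sum_(j < r.+1) (j == j0)%:R = 1 :> R.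
  rewrite (bigD1 j0) //= eqxx big1 ?addr0 // => j /negbTE-> //.
apply/rowP => k; rewrite summxE mxE.
by under eq_bigr do rewrite mxE; rewrite sumrB !sum1 subrr.
Qed.

(** Row [k] of the tensor sum is the sum over block [lift ord_max k] minus the sum over block
    [ord_max]. *)
Lemma sarkaria_independence r e n (f : 'I_n -> 'I_r.+1) (v : 'I_n -> 'rV[R]_e) :
    \sum_i (sarkaria_vector (f i))^T *m v i = 0 ->
  forall j, \sum_(i | f i == j) v i = \sum_(i | f i == ord_max) v i.
Proof.
move=> sum0 j; case: (unliftP ord_max j) => [k ->|-> //].
apply/rowP => l; apply/eqP; rewrite -subr_eq0; apply/eqP.
transitivity ((\sum_i (sarkaria_vector (f i))^T *m v i) k l); last by rewrite sum0 mxE.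
rewrite !summxE [X in X - _]big_mkcond [X in _ - X]big_mkcond /= -sumrB.
apply: eq_bigr => i _; rewrite mxE big_ord1 !mxE mulrBl.
by do 2![case: eqP => _]; rewrite ?mul1r ?mul0r.
Qed.

(** The colour class of [i] consists of the tensors of [y i] with the Sarkaria vectors, extended by
    a coordinate 1. Its average is [(0, 1)]; in a colourful representation of that vector the 0
    equates the block sums and the 1 normalizes [g]. *)
Theorem conic_tverberg r e n (y : 'I_n -> 'rV[R]_e) : (r * e + 1 <= n)%N ->
  exists (f : 'I_n -> 'I_r.+1) (g : 'I_n -> R) (w : 'rV[R]_e),
    [/\ forall i, 0 <= g i, \sum_i g i = 1
      & forall j, \sum_(i | f i == j) g i *: y i = w].
Proof.
move=> len.
pose u (i : 'I_n) (j : 'I_r.+1) : 'rV[R]_(r * e + 1) :=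
  row_mx (mxvec ((sarkaria_vector j)^T *m y i)) 1%:M.
have uE (I : finType) (c : I -> R) (h : I -> 'I_n) (k : I -> 'I_r.+1) :
    \sum_i c i *: u (h i) (k i) =
    row_mx (mxvec (\sum_i (sarkaria_vector (k i))^T *m (c i *: y (h i))))
      (\sum_i c i)%:M.
  rewrite linear_sum raddf_sum -[LHS]hsubmxK !linear_sum; congr row_mx.
    apply: eq_bigr => i _.
    by rewrite linearZ /= row_mxKl -scalemxAr linearZ.
  apply: eq_bigr => i _.
  by rewrite linearZ /= row_mxKr scale_scalar_mx mulr1.
pose t : R := r.+1%:R^-1.
have t0 : 0 <= t by rewrite invr_ge0 ler0n.
have sumt i : \sum_j t *: u i j = row_mx 0 1%:M.
  rewrite (uE _ (fun=> t) (fun=> i) id) -mulmx_suml -linear_sum /=.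
  rewrite sum_sarkaria_vector linear0 mul0mx linear0; congr (row_mx _ _%:M).
  by rewrite sumr_const card_ord -[t *+ _]mulr_natr mulVf // pnatr_eq0.
have [f [g [g0]]] := colorful_cone (lam := fun _ _ => t) len (fun _ _ => t0) sumt ord0.
rewrite (uE _ g id f) => /eq_row_mx[sum0 sum1].
exists f, g, (\sum_(i | f i == ord_max) g i *: y i); split=> //.
  by move/matrixP/(_ 0 0): sum1; rewrite !mxE.
apply: sarkaria_independence; apply: (can_inj mxvecK).
by rewrite sum0 linear0.
Qed.

End Tverberg.

(** * Support reduction, labellings and algebraic independence *)

Section Genericity.

Lemma set_dependency (K : fieldType) n m (v : 'I_n -> 'rV[K]_m) (B : {set 'I_n}) :
    (m < #|B|)%N ->
  exists c : 'I_n -> K, [/\ forall i, i \notin B -> c i = 0,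
    \sum_i c i *: v i = 0 & exists i, c i != 0].
Proof.
move=> ltmB.
have [|c [c0 [k ck]]] := @row_dependency _ _ _ (\matrix_(k < #|B|) v (enum_val k)).
  by rewrite /row_free neq_ltn (leq_ltn_trans (rank_leq_col _) ltmB).
exists (fun i => \sum_k c k * (enum_val k == i)%:R); split=> [i iB||].
- apply: big1 => l _; case: eqP => [li|_]; last by rewrite mulr0.
  by rewrite -li enum_valP in iB.
- rewrite -[RHS]c0; under eq_bigr do rewrite scaler_suml.
  rewrite exchange_big; apply: eq_bigr => l _; rewrite rowK.
  rewrite (bigD1 (enum_val l)) //= eqxx mulr1 big1 ?addr0 // => i.
  by rewrite eq_sym => /negbTE->; rewrite mulr0 scale0r.
exists (enum_val k); rewrite (bigD1 k) //= eqxx mulr1 big1 ?addr0 // => l lk.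
by rewrite (inj_eq enum_val_inj) (negbTE lk) mulr0.
Qed.

(** Caratheodory's reduction without signs: a block using more than [m] vectors has a dependency, a
    multiple of which removes one coefficient and keeps the block sum. *)
Lemma reduce_support (K : fieldType) n m r (f : 'I_n -> 'I_r)
    (v : 'I_n -> 'rV[K]_m) (g : 'I_n -> K) (w : 'rV[K]_m) :
    (forall j, \sum_(i | f i == j) g i *: v i = w) ->
  exists g' : 'I_n -> K, [/\ forall j, \sum_(i | f i == j) g' i *: v i = w,
    forall i, g i = 0 -> g' i = 0
  & forall j, (#|[set i | (g' i != 0%R) && (f i == j)]| <= m)%N].
Proof.
have [k] := ubnP #|[set i | g i != 0]|; elim: k g => // k IH g ltk gw.
case: (boolP [forall j, #|[set i | (g i != 0%R) && (f i == j)]| <= m])%N.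
  by move=> /forallP ltm; exists g.
rewrite negb_forall => /existsP[j0]; rewrite -ltnNge => /(set_dependency v).
move=> [c [cB c0 [i0 ci0]]].
have {}cB i : c i != 0 -> (g i != 0) && (f i == j0).
  by apply: contraR => niB; rewrite cB // inE.
pose h i := g i - g i0 / c i0 * c i.
have hg i : g i = 0 -> h i = 0.
  move=> gi; rewrite /h gi; case: (eqVneq (c i) 0) => [->|/cB].
    by rewrite mulr0 subr0.
  by rewrite gi eqxx.
have [|j|g' [g'w g'h lem]] := IH h.
- rewrite -ltnS; apply: leq_ltn_trans ltk; apply: proper_card.
  apply/properP; split.
    by apply/subsetP => i; rewrite !inE; apply: contra_neq => /hg.
  by exists i0; have /andP[gi0 _] := cB _ ci0; rewrite !inE ?gi0 // /h divfK // subrr eqxx.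
- have cj : \sum_(i | f i == j) c i *: v i = 0.
    case: (eqVneq j j0) => [->|jj0].
      rewrite -[RHS]c0 [RHS](bigID (fun i => f i == j0)) /=.
      rewrite [X in _ = _ + X]big1 ?addr0 // => i fi.
      have [->|/cB/andP[_ /eqP fij]] := eqVneq (c i) 0; first by rewrite scale0r.
      by rewrite fij eqxx in fi.
    apply: big1 => i /eqP fi.
    have [->|/cB/andP[_ /eqP fij]] := eqVneq (c i) 0; first by rewrite scale0r.
    by rewrite -fi fij eqxx in jj0.
  under eq_bigr do rewrite scalerBl -scalerA.
  by rewrite sumrB -scaler_sumr cj scaler0 subr0.
by exists g'; split=> // i /hg/g'h.
Qed.

(* Numbering the elements of S block after block and reducing modulo e, every
   label is used at most r times, hence is missed by one of the r + 1 blocks. *)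
Lemma block_labelling r e n (f : 'I_n -> 'I_r.+1) (S : {set 'I_n}) :
    (0 < e)%N -> (#|S| <= r * e)%N ->
    (forall j, #|[set i in S | f i == j]| <= e)%N ->
  exists l : 'I_n -> 'I_e,
    {in S &, forall i i', f i = f i' -> l i = l i' -> i = i'} /\
    forall k, exists j, forall i, i \in S -> f i = j -> l i != k.
Proof.
(* [key] orders by block, then by index; [rk] is the resulting position within [S]. *)
move=> e0 leS leSj; pose key (i : 'I_n) := (f i * n + i)%N.
pose below i := [set z in S | (key z < key i)%N]; pose rk i := #|below i|.
have key_inj i i' : key i = key i' -> i = i'.
  move=> E; apply: val_inj; have := congr1 (modn^~ n) E.
  by rewrite /key !modnMDl !modn_small.
have keyf i i' : (key i <= key i')%N -> (f i <= f i')%N.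
  rewrite /key; have := ltn_ord i; have := ltn_ord i'; nia.
have rkS i : i \in S -> (rk i < r * e)%N.
  move=> iS; apply: leq_trans leS; apply: proper_card; apply/properP; split.
    by apply/subsetP => z; rewrite inE => /andP[].
  by exists i; rewrite // inE ltnn andbF.
(* Positions within a block are consecutive and at most [e] in number, hence distinct modulo [e]. *)
have rk_block i i' : i \in S -> i' \in S -> f i = f i' -> (key i < key i')%N ->
    (rk i < rk i' < rk i + e)%N.
  move=> iS i'S ff ltk.
  have sub : below i \subset below i'.
    apply/subsetP => z; rewrite !inE => /andP[-> zi]; exact: ltn_trans zi ltk.
  have cD : #|below i'| = (#|below i| + #|below i' :\: below i|)%N.
    by rewrite -(cardsID (below i) (below i')) (setIidPr sub).
  apply/andP; split.
    apply: proper_card; apply/properP; split=> //.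
    by exists i; rewrite !inE ?iS ?ltk ?ltnn.
  rewrite /rk cD ltn_add2l; apply: leq_trans (leSj (f i)); apply: proper_card.
  apply/properP; split; last by exists i'; rewrite !inE ?i'S ?ff ?eqxx ?ltnn ?andbF.
  apply/subsetP => z; rewrite !inE => /andP[zi /andP[zS zi']].
  rewrite zS /= -leqNgt in zi *; have := keyf _ _ (ltnW zi'); have := keyf _ _ zi.
  by rewrite -ff -val_eqE /= eqn_leq => -> ->.
have rk_inj : {in S &, injective rk}.
  move=> i i' iS i'S E; apply: key_inj; wlog lt : i i' iS i'S E / (key i < key i')%N.
    move=> W; case: (ltngtP (key i) (key i')) => // lt; first exact: W.
    by apply/esym/W.
  have : (rk i < rk i')%N; last by rewrite E ltnn.
  apply: proper_card; apply/properP; split; last by exists i; rewrite !inE ?iS ?lt ?ltnn.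
  by apply/subsetP => z; rewrite !inE => /andP[-> zi]; apply: ltn_trans zi lt.
exists (fun i => Ordinal (ltn_pmod (rk i) e0)); split=> [i i' iS i'S ff [E]|k].
  wlog lt : i i' iS i'S ff E / (key i < key i')%N.
    move=> W; case: (ltngtP (key i) (key i')) => [lt|lt|/key_inj //]; first exact: W.
    by apply/esym/W.
  have /andP[lt1 lt2] := rk_block _ _ iS i'S ff lt.
  have : ((rk i' - rk i) %% e = 0)%N.
    by apply/eqP; rewrite -/(dvdn e _) -eqn_mod_dvd ?(ltnW lt1) // E.
  by rewrite modn_small; lia.
suff /existsP[j /forallP Hj] : [exists j, [forall i, (i \in S) && (f i == j) ==>
    (Ordinal (ltn_pmod (rk i) e0) != k)]].
  by exists j => i iS fi; have := Hj i; rewrite iS fi eqxx.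
(* If every block used label [k], then [r + 1] distinct positions below [r * e] would share a
   residue, although only [r] quotients are available. *)
rewrite -[X in is_true X]negbK negb_exists; apply/negP => /forallP all_hit.
have /fin_all_exists[x xP] j : exists i, [/\ i \in S, f i = j & (rk i %% e)%N = k].
  have := all_hit j; rewrite negb_forall => /existsP[i].
  rewrite negb_imply negbK => /andP[/andP[iS /eqP fi] /eqP <-].
  by exists i.
have qlt j : (rk (x j) %/ e < r)%N.
  by have [xS _ _] := xP j; rewrite ltn_divLR // rkS.
have /leq_card : injective (fun j => Ordinal (qlt j)).
  move=> j j' [E]; have [xS fx xk] := xP j; have [xS' fx' xk'] := xP j'.
  rewrite -[LHS]fx -[RHS]fx'; congr (f _); apply: rk_inj => //.
  by rewrite (divn_eq (rk (x j)) e) (divn_eq (rk (x j')) e) E xk xk'.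
by rewrite !card_ord ltnn.
Qed.

Definition mpoly_eval (K : numFieldType) (I : finType) (x : I -> K)
    (p : {mpoly rat[#|I|]}) : K :=
  mmap ratr (fun k => x (enum_val k)) p.

HB.instance Definition _ (K : numFieldType) (I : finType) (x : I -> K) :=
  GRing.RMorphism.copy (mpoly_eval x) (mmap (ratr : rat -> K) (fun k => x (enum_val k))).

(** Passes from exponent functions on [I] to multinomials through the enumeration of [I]. *)
Lemma alg_indep_mpoly (K : numFieldType) (I : finType) (x : I -> K) p :
  alg_indep x -> mpoly_eval x p = 0 -> p = 0.
Proof.
move=> xI p0.
pose to (m : 'X_{1.. #|I|}) := [ffun i => m (enum_rank i)].
pose of_ (e : {ffun I -> nat}) := [multinom e (enum_val k) | k < #|I|].
have toK : cancel to of_.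
  by move=> m; apply/mnmP => k; rewrite mnmE ffunE enum_valK.
apply/mpolyP => m; rewrite mcoeff0; case: (boolP (m \in msupp p)) => [mp|]; last first.
  by rewrite mcoeff_msupp negbK => /eqP.
have {1}-> : m = of_ (to m) by rewrite toK.
apply: (xI [seq to m' | m' <- msupp p] (fun e => p@_(of_ e))).
- by rewrite map_inj_uniq ?msupp_uniq //; apply: can_inj toK.
- rewrite -[RHS]p0 big_map; apply: eq_bigr => m' _; rewrite toK; congr (_ * _).
  rewrite /mmap1 (reindex (enum_val (A := I))) /=; last first.
    exact/onW_bij/enum_val_bij.
  by apply: eq_bigr => k _; rewrite ffunE enum_valK.
by rewrite map_f.
Qed.

Lemma kernel0_row_free (K : fieldType) n m (A : 'M[K]_(n, m)) :
  (forall v : 'rV_n, v *m A = 0 -> v = 0) -> row_free A.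
Proof.
move=> A0; rewrite -kermx_eq0; apply/eqP/row_matrixP => i.
by rewrite row0; apply: A0; rewrite -row_mul mulmx_ker row0.
Qed.

(* If F has independent rows at q then some rational matrix B makes
   det (F * B) equal to 1 at q, so this polynomial is nonzero and does not
   vanish at an algebraically independent point. *)
Lemma generic_independence (K : numFieldType) (I S T : finType) (x : I -> K)
    (q : I -> rat) (F : S -> T -> {mpoly rat[#|I|]}) :
    alg_indep x ->
    (forall c : S -> rat, (forall t, \sum_s c s * mpoly_eval q (F s t) = 0) ->
      forall s, c s = 0) ->
  forall c : S -> K, (forall t, \sum_s c s * mpoly_eval x (F s t) = 0) ->
    forall s, c s = 0.
Proof.
move=> xI q0 c c0.
pose D := \matrix_(i < #|S|, t < #|T|) F (enum_val i) (enum_val t).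
have eval_kernel (L : numFieldType) (y : I -> L) (v : 'rV_#|S|) t :
    (v *m map_mx (mpoly_eval y) D) 0 (enum_rank t) =
    \sum_s v 0 (enum_rank s) * mpoly_eval y (F s t).
  rewrite mxE (reindex enum_rank) /=; last exact/onW_bij/enum_rank_bij.
  by apply: eq_bigr => s _; rewrite !mxE !enum_rankK.
have /row_freeP[B DB] : row_free (map_mx (mpoly_eval q) D).
  apply: kernel0_row_free => v v0; apply/rowP => k; rewrite mxE -(enum_valK k).
  apply: (q0 (fun s => v 0 (enum_rank s))) => t.
  by rewrite -eval_kernel v0 mxE.
pose p := \det (D *m map_mx (@mpolyC _ _) B).
have px0 : mpoly_eval x p != 0.
  apply/eqP => /(alg_indep_mpoly xI) p0.
  have : mpoly_eval q p = 1.
    rewrite -det_map_mx map_mxM -map_mx_comp -[RHS](det1 _ #|S|) -DB.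
    (* Constants evaluate to themselves at [q], since [ratr] is the identity on the rationals. *)
    congr (\det (_ *m _)); apply/matrixP => i j; rewrite !mxE /=.
    rewrite /mpoly_eval mmapC; exact/esym/(fmorph_eq_rat idfun).
  by rewrite p0 rmorph0 => /eqP; rewrite eq_sym oner_eq0.
have free_x : row_free (map_mx (mpoly_eval x) D).
  apply/row_freeP; move: px0; rewrite -det_map_mx map_mxM -unitfE -unitmxE.
  set B' := map_mx _ (map_mx _ B) => /mulmxV; rewrite -mulmxA => DB'.
  by exists (B' *m invmx (map_mx (mpoly_eval x) D *m B')).
move=> s; have : (\row_k c (enum_val k)) *m map_mx (mpoly_eval x) D = 0.
  apply/rowP => t; rewrite -(enum_valK t) eval_kernel mxE -[RHS](c0 (enum_val t)).
  by apply: eq_bigr => s' _; rewrite mxE enum_rankK.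
move/eqP; rewrite mulmx_free_eq0 // => /eqP/rowP/(_ (enum_rank s)).
by rewrite !mxE enum_rankK.
Qed.

End Genericity.

(** * Generic points: no common point with missing coefficients *)

Section GenericTverberg.

Definition homogenize (K : pzRingType) d (v : 'rV[K]_d) : 'rV[K]_(d + 1) :=
  row_mx v 1%:M.

(** The spans of the blocks of lifted points of [S] meet only in 0, and each such block is
    independent. Being linear and free of signs, this is a rank condition, testable at one rational
    configuration. *)
Definition only_trivial_meet (K : fieldType) n r d (f : 'I_n -> 'I_r)
    (S : {set 'I_n}) (X : 'I_n -> 'rV[K]_d) : Prop :=
  forall (c : 'I_n -> K) (w : 'rV[K]_(d + 1)),
    (forall i, i \notin S -> c i = 0) ->
    (forall j, \sum_(i | f i == j) c i *: homogenize (X i) = w) ->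
  w = 0 /\ forall i, c i = 0.

Section MeetSystem.
Variables (n r d : nat) (f : 'I_n -> 'I_r) (S : {set 'I_n}).

(* Rows: the unknown coefficients c i and coordinates w k; columns: the
   equations of [only_trivial_meet], the second kind saying c i = 0 off S. *)
Definition meet_system (s : 'I_n + 'I_(d + 1)) (t : ('I_r * 'I_(d + 1)) + 'I_n) :
    {mpoly rat[#|{: 'I_n * 'I_d}|]} :=
  match s, t with
  | inl i, inl (j, k) => (f i == j)%:R *
      match split k with inl l => 'X_(enum_rank (i, l)) | inr _ => 1 end
  | inl i, inr i' => ((i == i') && (i \notin S))%:R
  | inr k', inl (j, k) => - (k' == k)%:R
  | inr _, inr _ => 0
  end.

Variables (K : numFieldType) (X : 'I_n -> 'rV[K]_d).
Local Notation ev := (mpoly_eval (fun ij : 'I_n * 'I_d => X ij.1 0 ij.2)).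

Lemma meet_systemE (c : 'I_n + 'I_(d + 1) -> K) j k :
  \sum_s c s * ev (meet_system s (inl (j, k))) =
  (\sum_(i | f i == j) c (inl i) *: homogenize (X i)) 0 k - c (inr k).
Proof.
rewrite big_sumType /= summxE [X in _ = X - _]big_mkcond /=; congr (_ + _).
  apply: eq_bigr => i _; rewrite rmorphM rmorph_nat /=.
  case: eqP => _; last by rewrite mul0r mulr0.
  rewrite mul1r !mxE; congr (_ * _); case: split => l.
    by rewrite /mpoly_eval mmapX mmap1U enum_rankK.
  by rewrite rmorph1 mxE ord1 eqxx.
rewrite (bigD1 k) //= big1 => [|k' /negbTE->]; rewrite rmorphN rmorph_nat.
  by rewrite eqxx mulrN1 addr0.
by rewrite oppr0 mulr0.
Qed.

Lemma meet_systemE_off (c : 'I_n + 'I_(d + 1) -> K) i :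
  \sum_s c s * ev (meet_system s (inr i)) = c (inl i) * (i \notin S)%:R.
Proof.
rewrite big_sumType /= [X in _ + X]big1 => [|k _]; last by rewrite rmorph0 mulr0.
rewrite addr0 (bigD1 i) //= big1 => [|i' /negbTE->]; rewrite rmorph_nat ?mulr0 //.
by rewrite eqxx addr0.
Qed.

Lemma meet_system_kernel : only_trivial_meet f S X <->
  forall c, (forall t, \sum_s c s * ev (meet_system s t) = 0) -> forall s, c s = 0.
Proof.
split=> [triv c c0|ker c w cS cw].
  have cE j : \sum_(i | f i == j) c (inl i) *: homogenize (X i) =
      \row_k c (inr k).
    apply/rowP => k; apply/eqP; rewrite [RHS in _ == RHS]mxE -subr_eq0.
    by rewrite -meet_systemE c0.
  have [|w0 ci0] := triv (fun i => c (inl i)) _ _ cE.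
    by move=> i iS; have := c0 (inr i); rewrite meet_systemE_off iS mulr1.
  by case=> // k; move/rowP/(_ k): w0; rewrite !mxE.
pose v s := match s with inl i => c i | inr k => w 0 k end.
have v0 s : v s = 0.
  apply: ker s => [[[j k]|i]]; first by rewrite meet_systemE cw subrr.
  rewrite meet_systemE_off /v; case: (boolP (i \in S)) => [_|/cS->].
    by rewrite mulr0.
  by rewrite mul0r.
split=> [|i]; last exact: (v0 (inl i)).
by apply/rowP => k; rewrite mxE; apply: (v0 (inr k)).
Qed.

End MeetSystem.

Lemma generic_only_trivial_meet (K : numFieldType) n r d (f : 'I_n -> 'I_r)
    (S : {set 'I_n}) (a : 'I_n -> 'rV[K]_d) (q : 'I_n -> 'rV[rat]_d) :
    alg_indep (fun ij : 'I_n * 'I_d => a ij.1 0 ij.2) ->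
  only_trivial_meet f S q -> only_trivial_meet f S a.
Proof.
move=> aI /meet_system_kernel q0; apply/meet_system_kernel.
exact: generic_independence aI q0.
Qed.

(* Points of S are placed at the vertices of a simplex according to their
   label; the vertex k is then absent from some block, so w, which lies in the
   span of every block, has no component along any vertex. *)
Lemma labelled_only_trivial_meet n r d (f : 'I_n -> 'I_r) (S : {set 'I_n})
    (l : 'I_n -> 'I_(d + 1)) :
    {in S &, forall i i', f i = f i' -> l i = l i' -> i = i'} ->
    (forall k, exists j, forall i, i \in S -> f i = j -> l i != k) ->
  only_trivial_meet f S (fun i => \row_k (l i == lshift 1 k)%:R : 'rV[rat]_d).
Proof.
move=> l_inj l_miss c w cS cw.
(* Total weight that block [j] puts on vertex [k]. *)
pose T j k := \sum_(i | (f i == j) && (l i == k)) c i.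
have Tl j k : T j (lshift 1 k) = w 0 (lshift 1 k).
  rewrite -(cw j) summxE /T big_mkcondr; apply: eq_bigr => i _.
  by rewrite mxE row_mxEl mxE; case: eqP => _; rewrite ?mulr1 ?mulr0.
have Tsum j : \sum_k T j k = w 0 (rshift d ord0).
  rewrite -(cw j) summxE -[LHS](partition_big l xpredT) //=.
  by apply: eq_bigr => i _; rewrite mxE row_mxEr mxE mulr1.
(* The last vertex is the origin; its weight is recovered from the homogenizing coordinate. *)
have T_eq j j' k : T j k = T j' k.
  case: (split_ordP k) => k' ->; first by rewrite !Tl.
  have := Tsum j; rewrite -(Tsum j') !big_split_ord /= !big_ord1 (ord1 k').
  under eq_bigr do rewrite Tl.
  by under [X in _ = X + _]eq_bigr do rewrite Tl; apply: addrI.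
have T0 j k : T j k = 0.
  have [j' missj'] := l_miss k; rewrite (T_eq j j').
  apply: big1 => i /andP[/eqP fi /eqP li]; apply: cS; apply/negP => iS.
  by have := missj' i iS fi; rewrite li eqxx.
split=> [|i].
  apply/rowP => k; have [j _] := l_miss k; rewrite mxE.
  case: (split_ordP k) => k' ->; first by rewrite -(Tl j) T0.
  by rewrite (ord1 k') -(Tsum j) big1.
case: (boolP (i \in S)) => [iS|]; last exact: cS.
rewrite -[RHS](T0 (f i) (l i)) /T (bigD1 i) ?eqxx //= big1 ?addr0 //.
move=> i' /andP[/andP[/eqP fi /eqP li] ii']; apply: cS; apply: contra ii' => iS'.
by apply/eqP/l_inj.
Qed.

(** If some [g i0] vanished, the reduced support would have at most [r * (d + 1)] points, with at
    most [d + 1] per block. A labelling then gives a rational configuration with trivial meet, and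
    genericity forces [w = 0]. *)
Theorem generic_tverberg_full_support (K : numFieldType) n r d
    (f : 'I_n -> 'I_r.+1) (a : 'I_n -> 'rV[K]_d) (g : 'I_n -> K) w :
    alg_indep (fun ij : 'I_n * 'I_d => a ij.1 0 ij.2) ->
    (n <= r * (d + 1) + 1)%N ->
    (forall j, \sum_(i | f i == j) g i *: homogenize (a i) = w) -> w != 0 ->
  forall i, g i != 0.
Proof.
move=> aI len gw w0 i0; apply/eqP => gi0.
have [g' [g'w g'0 g'_le]] := reduce_support gw.
have d0 : (0 < d + 1)%N by rewrite addn1.
pose S := [set i | g' i != 0].
have [||l [l_inj l_miss]] := @block_labelling r _ _ f S d0.
- rewrite -ltnS -[X in (_ < X)%N]addn1; apply: leq_trans len; rewrite -[X in (_ < X)%N](card_ord n).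
  rewrite -cardsT; apply: proper_card; apply/properP; split; first exact: subsetT.
  by exists i0; rewrite ?inE ?g'0 ?eqxx.
- move=> j; apply: leq_trans (g'_le j); apply/eq_leq/eq_card => i.
  by rewrite !inE.
have triv := generic_only_trivial_meet aI (labelled_only_trivial_meet l_inj l_miss).
have [|/eqP] := triv g' w _ g'w; last by rewrite (negbTE w0).
by move=> i; rewrite inE negbK => /eqP.
Qed.

End GenericTverberg.

(** * The partition, the separation hypothesis and the final assembly *)

Lemma fibre_partition (T : finType) r (f : T -> 'I_r) :
    (forall j, exists x, f x = j) ->
  let P := [set [set x | f x == j] | j : 'I_r] in
  partition P [set: T] /\ #|P| = r.
Proof.
move=> f_onto P; split; last first.
  rewrite card_imset ?card_ord // => j j' /setP E; have [x fx] := f_onto j.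
  by have := E x; rewrite !inE fx eqxx => /esym/eqP.
apply/and3P; split.
- apply/eqP/setP => x; rewrite inE; apply/bigcupP.
  by exists [set x' | f x' == f x]; rewrite ?inE // imset_f.
- apply/trivIsetP => A B /imsetP[j _ ->] /imsetP[j' _ ->] neAB.
  rewrite -setI_eq0; apply/eqP/setP => x; rewrite !inE; apply/negP.
  by case/andP=> /eqP fx /eqP fx'; rewrite -fx -fx' eqxx in neAB.
apply/imsetP => -[j _ /setP E]; have [x fx] := f_onto j.
by have := E x; rewrite !inE fx eqxx.
Qed.

(** In a vanishing sum the last coordinate gives [M] and its complement weight 1/2 each; doubled,
    the weights yield one point in both hulls. *)
Lemma disjoint_conv_no_signed_dependency (R : realFieldType) n d
    (a : 'I_n -> 'rV[R]_d) (M : {set 'I_n}) (g : 'I_n -> R) :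
    (forall z, ~ (in_conv a M z /\ in_conv a (~: M) z)) ->
    (forall i, 0 <= g i) -> \sum_i g i = 1 ->
  \sum_i g i *: ((-1) ^+ (i \in M) *: homogenize (a i)) != 0.
Proof.
move=> sep g0 g1; apply/eqP => sum0.
pose gM (B : {set 'I_n}) i := (i \in B)%:R * (2 * g i).
have signE i : g i * (-1) ^+ (i \in M) = (i \in ~: M)%:R * g i - (i \in M)%:R * g i.
  by rewrite inE; case: (i \in M); rewrite /= ?expr1 ?expr0; ring.
have sum_diff : \sum_i (i \in ~: M)%:R * g i = \sum_i (i \in M)%:R * g i.
  apply/eqP; rewrite -subr_eq0 -sumrB; apply/eqP.
  transitivity ((\sum_i g i *: ((-1) ^+ (i \in M) *: homogenize (a i))) 0 (rshift d ord0)).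
    rewrite summxE; apply: eq_bigr => i _.
    by rewrite scalerA mxE -signE row_mxEr mxE mulr1.
  by rewrite sum0 mxE.
have sum_half : \sum_i (i \in M)%:R * g i = 2^-1.
  have : \sum_i (i \in ~: M)%:R * g i + \sum_i (i \in M)%:R * g i = 1.
    rewrite -big_split -[RHS]g1; apply: eq_bigr => i _; rewrite inE.
    by case: (i \in M); rewrite /= mul0r mul1r ?addr0 ?add0r.
  by rewrite sum_diff => E; lra.
have gM0 B i : 0 <= gM B i by rewrite !mulr_ge0 ?ler0n.
have gM_off (B : {set 'I_n}) i : i \notin B -> gM B i = 0.
  by rewrite /gM => /negbTE->; rewrite mul0r.
have gM_sum B : \sum_i gM B i = 2 * \sum_i (i \in B)%:R * g i.
  by rewrite mulr_sumr; apply: eq_bigr => i _; rewrite /gM mulrCA.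
apply: (sep (\sum_i gM M i *: a i)); split.
  exists (gM M); split=> //; first exact: gM_off.
  by rewrite gM_sum sum_half mulfV // pnatr_eq0.
exists (gM (~: M)); split=> //; first exact: gM_off.
  by rewrite gM_sum sum_diff sum_half mulfV // pnatr_eq0.
apply/eqP; rewrite eq_sym -subr_eq0 -sumrB; apply/eqP.
transitivity (2 *: lsubmx (\sum_i g i *: ((-1) ^+ (i \in M) *: homogenize (a i)))).
  rewrite linear_sum scaler_sumr; apply: eq_bigr => i _; rewrite -scalerBl.
  rewrite !linearZ /= row_mxKl !scalerA signE /gM.
  by congr (_ *: _); ring.
by rewrite sum0 !linear0.
Qed.

Unset Implicit Arguments.

Theorem mainTheorem2 (R : rcfType) (r d n : nat)
    (hr : (2 <= r)%N) (hd : (1 <= d)%N) (hn : n = ((r - 1) * (d + 1) + 1)%N)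
    (a : 'I_n -> 'rV[R]_d) (a_inj : injective a)
    (a_indep : alg_indep (fun ij : 'I_n * 'I_d => a ij.1 0 ij.2))
    (M : {set 'I_n}) (hM : (#|M| <= r - 1)%N)
    (hsep : forall z, ~ (in_conv a M z /\ in_conv a (~: M) z)) :
  exists (P : {set {set 'I_n}}) (z : 'rV[R]_d) (alpha : 'I_n -> R),
    [/\ partition P [set: 'I_n], #|P| = r,
        forall B, B \in P ->
          z = \sum_(i in B) alpha i *: a i /\ \sum_(i in B) alpha i = 1
      & forall i, alpha i < 0 <-> i \in M].
Proof.
(* From here on there are [r.+1] blocks. *)
case: r hr hn hM => // r _; rewrite subSS subn0 => hn hM.
pose sg i : R := (-1) ^+ (i \in M).
pose y i := sg i *: homogenize (a i).
have [|f [g [w [g0 g1 gw]]]] := @conic_tverberg R r (d + 1) n y; first by rewrite hn.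
have w0 : w != 0.
  apply: contraNneq (disjoint_conv_no_signed_dependency hsep g0 g1) => w0.
  rewrite (partition_big f xpredT) //= big1 // => j _.
  by rewrite -[RHS]w0 -(gw j).
have sgw j : \sum_(i | f i == j) (g i * sg i) *: homogenize (a i) = w.
  by rewrite -(gw j); apply: eq_bigr => i _; rewrite scalerA.
have gpos i : 0 < g i.
  have /(_ i) := generic_tverberg_full_support a_indep (eq_leq hn) sgw w0.
  by rewrite mulf_eq0 negb_or lt_neqAle g0 eq_sym => /andP[-> _].
pose t := w 0 (rshift d ord0).
have tE j : t = \sum_(i | f i == j) g i * sg i.
  rewrite /t -(sgw j) summxE; apply: eq_bigr => i _.
  by rewrite mxE row_mxEr mxE mulr1.
(* An empty block would have sum 0, against [w != 0]. *)
have f_onto j : exists i, f i = j.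
  suff /existsP[i /eqP fi] : [exists i, f i == j] by exists i.
  apply: contraNT w0; rewrite negb_exists => /forallP nf.
  by rewrite -(sgw j) big1 // => i fi; have := nf i; rewrite fi.
(* As M has at most r - 1 points, some block avoids M; all its signs are +1. *)
have t0 : 0 < t.
  have [j jM] : exists j, j \notin f @: M.
    apply/existsP; rewrite -negb_forall; apply/negP => /forallP all_hit.
    have : (#|f @: M| <= r)%N := leq_trans (leq_imset_card f _) hM.
    by rewrite (eq_card (B := 'I_r.+1)) ?card_ord ?ltnn // => j; rewrite all_hit.
  have [i0 fi0] := f_onto j.
  rewrite (tE j) (bigD1 i0) ?fi0 //=; apply: ltr_wpDr.
    apply: sumr_ge0 => i /andP[/eqP fi _]; apply: mulr_ge0 => //.
    rewrite /sg (negbTE (_ : i \notin M)) //.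
    by apply: contra jM => iM; rewrite -fi imset_f.
  rewrite /sg (negbTE (_ : i0 \notin M)) ?mulr1 //.
  by apply: contra jM => iM; rewrite -fi0 imset_f.
(* As [t] and [g i] are positive, [alpha i] has the sign of [sg i]. *)
pose alpha i := t^-1 * (g i * sg i).
have [Ppart Pcard] := fibre_partition f_onto.
exists [set [set i | f i == j] | j : 'I_r.+1], (t^-1 *: lsubmx w), alpha.
split=> // [B /imsetP[j _ ->]|i].
  split; last first.
    under eq_bigl do rewrite inE.
    by rewrite -mulr_sumr -tE mulVf // gt_eqF.
  under eq_bigl do rewrite inE.
  rewrite -(sgw j) linear_sum scaler_sumr; apply: eq_bigr => i _.
  by rewrite linearZ /= row_mxKl scalerA.
rewrite /alpha pmulr_rlt0 ?invr_gt0 // pmulr_rlt0 // /sg.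
by case: (i \in M); rewrite ?expr1 ?expr0 ?ltrN10 ?ltr10.
Qed.
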